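(* Let $K_1,K_2\subset\mathbb{R}^2$ be convex bodies. Then there exists a unimodular transformation $g\in\mathrm{GL}_2(\mathbb{Z})$ such that for all $\lambda\in[0,1]$ $$\mu\big((1-\lambda)K_1+g\cdot\lambda K_2\big)^{-1}\ \ge\ (1-\lambda)\,\mu(K_1)^{-1}+\lambda\,\mu(K_2)^{-1}.$$
   Context: A convex body is a non-empty compact convex set. The covering radius of a convex body $K\subset\mathbb{R}^d$ is $\mu(K)=\inf\{\mu\ge 0:\mu K+\mathbb{Z}^d=\mathbb{R}^d\}$; if $K$ is lower-dimensional, then $\mu(K)=\infty$ and one sets $\mu(K)^{-1}=0$. $\mathrm{GL}_2(\mathbb{Z})$ is the group of matrices $g\in\mathbb{Z}^{2\times2}$ that have an inverse in $\mathbb{Z}^{2\times 2}$; $g\cdot\lambda K_2$ is the image of $\lambda K_2$ under $g$, and $+$ is the Minkowski sum. *)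

(* Defs.v *)
From mathcomp Require Import all_boot all_order all_algebra.
From mathcomp Require Import all_classical all_reals all_analysis.
Import Order.TTheory GRing.Theory Num.Theory.
Import numFieldNormedType.Exports.

Set Implicit Arguments.
Unset Strict Implicit.
Unset Printing Implicit Defensive.

Local Open Scope classical_set_scope.
Local Open Scope ring_scope.

Definition convex_body (R : realType) (d : nat) (K : set 'cV[R]_d) : Prop :=
  [/\ K !=set0, compact K & convex_set K].

Definition dilate (R : realType) (d : nat) (a : R) (K : set 'cV[R]_d) :
  set 'cV[R]_d := [set a *: x | x in K].

Definition minkowski_sum (R : realType) (d : nat) (A B : set 'cV[R]_d) :
  set 'cV[R]_d := [set x + y | x in A & y in B].

Definition integer_lattice (R : realType) (d : nat) : set 'cV[R]_d :=
  range (fun z : 'cV[int]_d => map_mx intr z).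

Definition int_image (R : realType) (d : nat) (g : 'M[int]_d)
  (K : set 'cV[R]_d) : set 'cV[R]_d := [set map_mx intr g *m x | x in K].

(* If K is lower-dimensional, no dilate of K covers the space modulo the
   lattice, so this is the infimum of the empty set, namely +oo; the inverse
   [inve] of extended reals then maps it to 0. *)
Definition covering_radius (R : realType) (d : nat) (K : set 'cV[R]_d) :
  \bar R :=
  ereal_inf [set m%:E | m in [set m : R | 0 <= m /\
    minkowski_sum (dilate m K) (@integer_lattice R d) = setT]].

(* Main.v *)
Require Import Defs.
From mathcomp Require Import all_boot all_order all_algebra.
From mathcomp Require Import all_classical all_reals all_analysis.
From mathcomp Require Import ring lra zify.
Import Order.TTheory GRing.Theory Num.Theory.
Import numFieldNormedType.Exports.

(* A body containing translates of the triangles [conv(0, u, v)] and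
   [- conv(0, u, v)], for a lattice basis [(u, v)], covers the plane. Conversely,
   for every body [K] there is a basis such that both triangles fit in
   [covering_radius K *: K]. Choosing [g] to map the basis of [K2] to that of [K1]
   proves the theorem, since containing dilates of two fixed triangles is
   preserved by Minkowski combinations.

   The converse picks a basis minimising the size [s] of the homothets of [K]
   needed to contain both triangles. If [s] exceeded the covering radius, every
   homothet of size [s] would contain a lattice point in its interior; as in the
   theory of Delaunay triangulations, such a point in a homothet around one of the
   triangles allows one to flip an edge of the triangulation and to decrease [s]. *)

Set Implicit Arguments.
Unset Strict Implicit.
Unset Printing Implicit Defensive.

Local Open Scope classical_set_scope.
Local Open Scope ring_scope.

(** * Algebraic interior and homothets of a convex set *)

Ltac vring := apply/matrixP => ? ?; rewrite !mxE; ring.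
Ltac vfield := apply/matrixP => ? ?; rewrite !mxE; field.

Lemma convex_set_combine (R : realType) (V : lmodType R) (A : set V) x y (a b : R) :
  convex_set A -> A x -> A y -> 0 <= a -> 0 <= b -> a + b = 1 ->
  A (a *: x + b *: y).
Proof.
move=> cA Ax Ay a0 b0 ab.
have a01 : 0 <= a <= 1 by rewrite a0 -ab lerDl b0.
have /set_mem := cA x y (Itv01 (andP a01).1 (andP a01).2) (mem_set Ax) (mem_set Ay).
by rewrite /conv /= /unstable.onem -[in 1 - a]ab addrAC subrr add0r.
Qed.

Lemma convex_set_combine3 (R : realType) (V : lmodType R) (A : set V)
    x y z (a b c : R) :
  convex_set A -> A x -> A y -> A z -> 0 <= a -> 0 <= b -> 0 <= c ->
  a + b + c = 1 -> A (a *: x + b *: y + c *: z).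
Proof.
move=> cA Ax Ay Az a0 b0 c0 abc.
have [ab0|ab0] := eqVneq (a + b) 0.
  have -> : a = 0 by lra.
  have -> : b = 0 by lra.
  have -> : c = 1 by lra.
  by rewrite !scale0r !add0r scale1r.
have -> : a *: x + b *: y = (a + b) *: ((a / (a + b)) *: x + (b / (a + b)) *: y).
  by rewrite scalerDr !scalerA; congr (_ *: _ + _ *: _); field.
have ab : 0 <= a + b by lra.
apply: convex_set_combine => //; apply: convex_set_combine => //.
- by rewrite divr_ge0.
- by rewrite divr_ge0.
- by field.
Qed.

Lemma convex_setP (R : realType) (V : lmodType R) (A : set V) :
  (forall x y (a b : R), A x -> A y -> 0 <= a -> 0 <= b -> a + b = 1 ->
    A (a *: x + b *: y)) -> convex_set A.
Proof.
move=> h x y l /set_mem Ax /set_mem Ay; apply/mem_set; apply: h => //.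
- by rewrite subr_ge0.
- by rewrite /unstable.onem addrC subrK.
Qed.

(** The algebraic interior, tested line by line, so that membership is proved by explicit convex
    weights. *)
Definition core (R : realType) (V : lmodType R) (C : set V) : set V :=
  [set x | forall d, exists2 e : R, 0 < e & forall t, `|t| <= e -> C (x + t *: d)].

Lemma core_sub (R : realType) (V : lmodType R) (C : set V) : core C `<=` C.
Proof.
by move=> x /(_ 0)[e e0 /(_ 0)]; rewrite normr0 scale0r addr0; apply; exact: ltW.
Qed.

(** A segment around [z] is scaled by [a > 0] in the combination and so keeps positive length. *)
Lemma core_combine3 (R : realType) (V : lmodType R) (C : set V) z x y (a b c : R) :
  convex_set C -> core C z -> C x -> C y -> 0 < a -> 0 <= b -> 0 <= c ->
  a + b + c = 1 -> core C (a *: z + b *: x + c *: y).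
Proof.
move=> cC zC Cx Cy a0 b0 c0 abc d; have [e e0 he] := zC d.
exists (a * e) => [|t te]; first exact: mulr_gt0.
have -> : a *: z + b *: x + c *: y + t *: d =
          a *: (z + (t / a) *: d) + b *: x + c *: y.
  rewrite scalerDr scalerA mulrC divfK ?gt_eqF// -!addrA; congr (_ + _).
  by rewrite [RHS]addrC addrA.
apply: convex_set_combine3 => //; last exact: ltW.
by apply: he; rewrite normrM normfV (gtr0_norm a0) ler_pdivrMr// mulrC.
Qed.

Arguments core_combine3 {R V C z x y a b c}.

Lemma core_combine (R : realType) (V : lmodType R) (C : set V) z x (a b : R) :
  convex_set C -> core C z -> C x -> 0 < a -> 0 <= b -> a + b = 1 ->
  core C (a *: z + b *: x).
Proof.
move=> cC zC Cx a0 b0 ab.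
have abC : a + b + 0 = 1 by rewrite addr0.
have := core_combine3 cC zC Cx Cx a0 b0 (lexx 0) abC.
by rewrite scale0r addr0.
Qed.

Arguments core_combine {R V C z x a b}.

Section Homothets.
Variables (R : realType) (K : set 'cV[R]_2).
Hypothesis cK : convex_set K.
Implicit Types (a b c x y u v w : 'cV[R]_2) (s t : R).

Definition homothet y s : set 'cV[R]_2 := [set y + s *: k | k in K].

Lemma homothet_convex y s : convex_set (homothet y s).
Proof.
apply: convex_setP => _ _ a b [k Kk <-] [l Kl <-] a0 b0 ab.
exists (a *: k + b *: l); first exact: convex_set_combine.
have -> : b = 1 - a by lra.
vring.
Qed.

Lemma homothetD y s x w : homothet y s x -> homothet (y + w) s (x + w).
Proof. by move=> [k Kk <-]; exists k => //; rewrite addrAC. Qed.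

(** By convexity, position and size of homothets can be interpolated together. Total size [0] is
    separate because the weights are quotients by it. *)
Lemma homothet_mix y y' s s' x x' t : 0 <= s -> 0 <= s' -> 0 <= t <= 1 ->
  homothet y s x -> homothet y' s' x' ->
  homothet ((1 - t) *: y + t *: y') ((1 - t) * s + t * s')
           ((1 - t) *: x + t *: x').
Proof.
move=> s0 s'0 /andP[t0 t1] [k Kk <-] [k' Kk' <-].
set r := (1 - t) * s + t * s'.
have p0 : 0 <= (1 - t) * s by apply: mulr_ge0 => //; lra.
have q0 : 0 <= t * s' by apply: mulr_ge0.
have [r0|r0] := eqVneq r 0.
  exists k => //; rewrite r0.
  have p1 : (1 - t) * s = 0 by rewrite /r in r0; lra.
  have q1 : t * s' = 0 by rewrite /r in r0; lra.
  by rewrite !scalerDr !scalerA p1 q1 !scale0r !addr0.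
have rp : 0 <= r by rewrite addr_ge0.
exists (((1 - t) * s / r) *: k + (t * s' / r) *: k').
  apply: convex_set_combine => //; try exact: divr_ge0.
  by rewrite -mulrDl divff.
by vfield.
Qed.

(** The least such [s] is the size of the smallest homothet of [K] circumscribed about the
    triangle. *)
Definition fits s a b c : Prop :=
  exists y, [/\ homothet y s a, homothet y s b & homothet y s c].

Definition fits_below s a b c : Prop :=
  exists2 s', 0 <= s' < s & fits s' a b c.

Lemma fits_translate w s a b c : fits s a b c -> fits s (a + w) (b + w) (c + w).
Proof. by case=> y [ya yb yc]; exists (y + w); split; exact: homothetD. Qed.

Lemma fits_rot s a b c : fits s a b c -> fits s b c a.
Proof. by case=> y [ya yb yc]; exists y. Qed.

Lemma fits_swap s a b c : fits s a b c -> fits s a c b.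
Proof. by case=> y [ya yb yc]; exists y. Qed.

Lemma homothet_grow y s s' : 0 <= s <= s' -> K !=set0 ->
  exists y', homothet y s `<=` homothet y' s'.
Proof.
(* With this position, [k0] gives the same point [y + s *: k0] in both homothets. *)
move=> /andP[s0 ss'] [k0 Kk0]; exists (y - (s' - s) *: k0) => _ [k Kk <-].
have [s'0|s'0] := eqVneq s' 0.
  have s00 : s = 0 by lra.
  by exists k => //; rewrite s'0 s00 !subrr !scale0r subr0.
have s'p : 0 < s' by lra.
exists ((s / s') *: k + ((s' - s) / s') *: k0); last by vfield.
apply: convex_set_combine => //; last by field.
- by rewrite divr_ge0 // ltW.
- by rewrite divr_ge0 ?subr_ge0 // ltW.
Qed.

Lemma fits_grow s s' a b c : 0 <= s <= s' -> K !=set0 ->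
  fits s a b c -> fits s' a b c.
Proof.
move=> ss' K0 [y [ya yb yc]]; have [y' yy'] := homothet_grow y ss' K0.
by exists y'; split; exact: yy'.
Qed.

(* Mixing the large homothet with a smaller one through [a] and [b] moves the
   interior point [c] only slightly. *)
Lemma fits_below_core y s a b c y' s' : 0 <= s' < s ->
  homothet y s a -> homothet y s b -> core (homothet y s) c ->
  homothet y' s' a -> homothet y' s' b -> fits_below s a b c.
Proof.
move=> /andP[s'0 s's] ya yb yc y'a y'b; have [e e0 he] := yc (c - a).
have ce : homothet y s (c + e *: (c - a)) by apply: he; rewrite gtr0_norm.
have e1 : 1 + e != 0 by lra.
(* This weight makes [c] the mixture of [c + e *: (c - a)] in the large homothet and [a] in the
   small one. *)
have t01 : 0 <= e / (1 + e) <= 1.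
  by apply/andP; split; [rewrite divr_ge0; lra|rewrite ler_pdivrMr; lra].
have tp : 0 < e / (1 + e) by rewrite divr_gt0; lra.
have s0 : 0 <= s by lra.
set t := e / (1 + e) in t01 tp *.
exists ((1 - t) * s + t * s').
  have -> : (1 - t) * s + t * s' = s - t * (s - s') by ring.
  have ss' : 0 < s - s' by lra.
  have := mulr_gt0 tp ss'.
  have : t * (s - s') <= s - s' by rewrite ler_piMl //; lra.
  by move=> *; lra.
exists ((1 - t) *: y + t *: y').
have mix x x' := @homothet_mix y y' s s' x x' t s0 s'0 t01.
split.
- by have := mix _ _ ya y'a; rewrite -scalerDl subrK scale1r.
- by have := mix _ _ yb y'b; rewrite -scalerDl subrK scale1r.
- have := mix _ _ ce y'a; congr homothet.
  by rewrite /t; vfield.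
Qed.

(* Prolonging [q, p] beyond the interior point [p] shows that [p - q] is the
   difference of two points of a smaller dilate. *)
Lemma core_chord y s p q : 0 < s ->
  core (homothet y s) p -> homothet y s q -> exists2 s', 0 <= s' < s &
  forall a, exists2 y', homothet y' s' a & homothet y' s' (a + (p - q)).
Proof.
move=> s0 yp yq; have [e e0 he] := yp (p - q).
have [k Kk kE] : homothet y s (p + e *: (p - q)) by apply: he; rewrite gtr0_norm.
case: yq kE => l Kl <- kE.
have e1 : 1 + e != 0 by lra.
(* Here [(1 + e) *: (p - q) = s *: (k - l)]. *)
exists (s / (1 + e)).
  rewrite divr_ge0 /=; [|lra|lra].
  by rewrite ltr_pdivrMr ?ltr_pMr; lra.
move=> a; exists (a - (s / (1 + e)) *: l); first by exists l => //; rewrite subrK.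
exists k => //.
have -> : p = (1 + e)^-1 *: (y + s *: k + e *: (y + s *: l)).
  by rewrite kE; vfield.
by vfield.
Qed.

(** The chord from [q] to [p] yields a smaller homothet through the parallel edge at [a]; mixing it
    in keeps the interior vertex [c]. *)
Lemma fits_below_chord y s p q a c : 0 < s ->
  core (homothet y s) p -> homothet y s q -> homothet y s a ->
  homothet y s (a + (p - q)) -> core (homothet y s) c ->
  fits_below s a (a + (p - q)) c.
Proof.
move=> s0 yp yq ya yb yc; have [s' ss' /(_ a)[y' y'a y'b]] := core_chord s0 yp yq.
exact: (fits_below_core ss' ya yb yc y'a y'b).
Qed.
End Homothets.

(** * Flipping an edge *)

Section LatticeBasis.
Variable R : realType.
Implicit Types u v : 'cV[R]_2.

Definition lattice_basis u v : Prop :=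
  exists2 g : 'M[int]_2, g \in unitmx &
    u = map_mx intr (col 0 g) /\ v = map_mx intr (col 1 g).

Lemma lattice_basis_change u v (a b c d : int) : lattice_basis u v ->
  (a * d - b * c) \is a GRing.unit ->
  lattice_basis (a%:~R *: u + b%:~R *: v) (c%:~R *: u + d%:~R *: v).
Proof.
move=> [g gU [-> ->]] h.
pose m : 'M[int]_2 := \matrix_(i, j)
  if i == 0 then (if j == 0 then a else c) else (if j == 0 then b else d).
exists (g *m m).
  rewrite unitmx_mul gU unitmxE (expand_det_row _ 0) !big_ord_recl big_ord0 addr0.
  by rewrite /cofactor !det_mx11 !mxE /= !expr0 !expr1 mul1r mulN1r mulrN (mulrC c).
split; apply/matrixP => i j; rewrite !mxE !big_ord_recl big_ord0 addr0 !mxE /=.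
- rewrite rmorphD !rmorphM /= [_ * a%:~R]mulrC [_ * b%:~R]mulrC.
  by congr (_ * _%:~R + _ * _%:~R); congr (fun_of_matrix g _ _); apply/val_inj.
- rewrite rmorphD !rmorphM /= [_ * c%:~R]mulrC [_ * d%:~R]mulrC.
  by congr (_ * _%:~R + _ * _%:~R); congr (fun_of_matrix g _ _); apply/val_inj.
Qed.

Lemma lattice_basis_flip u v : lattice_basis u v -> lattice_basis u (u + v).
Proof.
move=> uv; have := @lattice_basis_change u v 1 0 1 1 uv isT.
by rewrite !scale1r scale0r addr0.
Qed.

(** Moving the vertex [u] to the origin turns the triangle [0, u, v] into [- u, 0, v - u]. Results
    about the vertex [0] thus pass to the other vertices. *)
Lemma lattice_basis_rot u v : lattice_basis u v -> lattice_basis (v - u) (- u).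
Proof.
move=> uv; have := @lattice_basis_change u v (-1) 1 (-1) 0 uv isT.
by rewrite !scaleN1r scale1r scale0r addr0 addrC.
Qed.

Lemma lattice_basisN u v : lattice_basis u v -> lattice_basis (- u) (- v).
Proof.
move=> uv; have := @lattice_basis_change u v (-1) 0 0 (-1) uv isT.
by rewrite !scaleN1r !scale0r addr0 add0r.
Qed.

Lemma lattice_basis_span u v x : lattice_basis u v -> @integer_lattice R 2 x ->
  exists b c : int, x = b%:~R *: u + c%:~R *: v.
Proof.
move=> [g gU [-> ->]] [z _ <-].
exists ((invmx g *m z) 0 0), ((invmx g *m z) 1 0).
rewrite -{1}(mulKVmx gU z); move: (invmx g *m z) => w.
apply/matrixP => i j; rewrite !mxE !big_ord_recl big_ord0 addr0.
rewrite rmorphD !rmorphM /= (ord1 j) [X in X + _]mulrC [X in _ + X]mulrC.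
by congr (_%:~R * _%:~R + _%:~R * _%:~R); congr (fun_of_matrix _ _ _); apply/val_inj.
Qed.

Lemma lattice_basis_comb u v (b c : int) : lattice_basis u v ->
  @integer_lattice R 2 (b%:~R *: u + c%:~R *: v).
Proof.
move=> [g _ [-> ->]]; exists (b *: col 0 g + c *: col 1 g) => //.
by apply/matrixP => i j; rewrite !mxE rmorphD !rmorphM.
Qed.
End LatticeBasis.

Section Flips.
Variables (R : realType) (K : set 'cV[R]_2) (s : R).
Hypotheses (cK : convex_set K) (kK : compact K) (s0 : 0 < s).
Implicit Types (u v x y : 'cV[R]_2).
Local Notation H := (homothet K).
Local Notation fits_below := (fits_below K).

(** This is what contradicts the choice of a basis of least size [s]. *)
Definition improvable := exists u v, [/\ lattice_basis u v,
  fits_below s 0 u v & fits_below s 0 (- u) (- v)].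

Lemma fits_below_translate w t a b c :
  fits_below t a b c -> fits_below t (a + w) (b + w) (c + w).
Proof. by move=> [t' tt' h]; exists t' => //; exact: fits_translate. Qed.

Lemma fits_below_rot t a b c : fits_below t a b c -> fits_below t b c a.
Proof. by move=> [t' tt' h]; exists t' => //; exact: fits_rot. Qed.

Lemma fits_below_swap t a b c : fits_below t a b c -> fits_below t a c b.
Proof. by move=> [t' tt' h]; exists t' => //; exact: fits_swap. Qed.

Lemma core_homothetD y t x w : core (H y t) x -> core (H (y + w) t) (x + w).
Proof.
move=> h d; have [e e0 he] := h d; exists e => // r re.
by rewrite addrAC; apply: homothetD; exact: he.
Qed.

(** The diagonal [[u, v]] is flipped to [[0, u + v]]. Each new triangle has the interior vertex
    [u + v], and its side opposite to it is parallel to a chord ending at [u + v]. *)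
Lemma improvable_parallelogram y u v : lattice_basis u v ->
  H y s 0 -> H y s u -> H y s v -> core (H y s) (u + v) -> improvable.
Proof.
move=> uv h0 hu hv huv; have huv' := core_sub huv.
exists u, (u + v); split; first exact: lattice_basis_flip.
- have := @fits_below_chord _ _ cK y s (u + v) v 0 (u + v) s0 huv hv h0.
  by rewrite add0r addrK; apply.
- have := @fits_below_chord _ _ cK y s (u + v) u 0 (u + v) s0 huv hu h0.
  rewrite add0r addrAC subrr add0r => /(_ hv huv).
  move=> /(fits_below_translate (- (u + v))) /fits_below_rot /fits_below_rot.
  have -> : v - (u + v) = - u by vring.
  by rewrite subrr add0r => /fits_below_swap.
Qed.

(** Translation by [- (u + v)] makes [0] the far corner of the parallelogram on [- u] and [- v]. *)
Lemma improvable_parallelogram0 y u v : lattice_basis u v ->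
  core (H y s) 0 -> H y s u -> H y s v -> H y s (u + v) -> improvable.
Proof.
move=> uv h0 hu hv huv.
apply: (@improvable_parallelogram (y - (u + v)) (- u) (- v)).
- exact: lattice_basisN.
- by rewrite -(subrr (u + v)); exact: homothetD.
- have -> : - u = v - (u + v) by vring.
  exact: homothetD.
- have -> : - v = u - (u + v) by vring.
  exact: homothetD.
- have -> : - u + - v = 0 - (u + v) by vring.
  exact: core_homothetD.
Qed.

(* [u + v] is a convex combination of [u], [v] and the lattice point. *)
Lemma improvable_edge y u v (b c : int) : lattice_basis u v ->
  H y s 0 -> H y s u -> H y s v -> 1 <= b -> 1 <= c ->
  core (H y s) (b%:~R *: u + c%:~R *: v) -> improvable.
Proof.
move=> uv h0 hu hv b1 c1 hbc; apply: (improvable_parallelogram uv h0 hu hv).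
have {}b1 : (1 : R) <= b%:~R by rewrite ler1z.
have {}c1 : (1 : R) <= c%:~R by rewrite ler1z.
move: b%:~R c%:~R b1 c1 hbc => {}b {}c b1 c1 hbc.
have a0 : 0 < b + c - 1 by lra.
have := core_combine3 (a := (b + c - 1)^-1) (b := (c - 1) / (b + c - 1))
  (c := (b - 1) / (b + c - 1)) (homothet_convex cK (y := y) (s := s)) hbc hu hv.
have -> : (b + c - 1)^-1 *: (b *: u + c *: v) + ((c - 1) / (b + c - 1)) *: u +
  ((b - 1) / (b + c - 1)) *: v = u + v by vfield; lra.
apply.
- by rewrite invr_gt0.
- by rewrite divr_ge0; lra.
- by rewrite divr_ge0; lra.
- by field; lra.
Qed.

(** The origin is a convex combination of [u], [v] and the interior point, with positive weight on
    the latter. *)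
Lemma core_vertex y u v (b c : int) :
  H y s u -> H y s v -> b <= 0 -> c <= 0 ->
  core (H y s) (b%:~R *: u + c%:~R *: v) -> core (H y s) 0.
Proof.
move=> hu hv b1 c1 hbc.
have {}b1 : b%:~R <= (0 : R) by rewrite lerz0.
have {}c1 : c%:~R <= (0 : R) by rewrite lerz0.
move: b%:~R c%:~R b1 c1 hbc => {}b {}c b1 c1 hbc.
have := core_combine3 (a := (1 - b - c)^-1) (b := - b / (1 - b - c))
  (c := - c / (1 - b - c)) (homothet_convex cK (y := y) (s := s)) hbc hu hv.
have -> : (1 - b - c)^-1 *: (b *: u + c *: v) + (- b / (1 - b - c)) *: u +
  (- c / (1 - b - c)) *: v = 0 by vfield; lra.
apply.
- by rewrite invr_gt0; lra.
- by rewrite divr_ge0; lra.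
- by rewrite divr_ge0; lra.
- by field; lra.
Qed.

(* The lattice point is [a *: 0 + b *: u + c *: v] with [a + b + c = 1]: it lies
   beyond an edge if two coefficients are positive, and beyond a vertex if only
   one is. *)
Lemma improvable_triangle y u v (b c : int) : lattice_basis u v ->
  H y s 0 -> H y s u -> H y s v ->
  ~ core (H y s) 0 -> ~ core (H y s) u -> ~ core (H y s) v ->
  core (H y s) (b%:~R *: u + c%:~R *: v) -> improvable.
Proof.
move=> uv h0 hu hv n0 nu nv hbc.
set a : int := 1 - b - c.
have uv1 := lattice_basis_rot uv; have uv2 := lattice_basis_rot uv1.
(* The same lattice point seen from the vertices [u] and [v]: its coefficients are permuted
   cyclically. *)
have h1 : core (H (y - u) s) (c%:~R *: (v - u) + a%:~R *: (- u)).
  have := core_homothetD (- u) hbc; congr core.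
  by rewrite /a !rmorphB /=; vring.
have h2 : core (H (y - v) s) (a%:~R *: (- v) + b%:~R *: (u - v)).
  have := core_homothetD (- v) hbc; congr core.
  by rewrite /a !rmorphB /=; vring.
have e1 : - u - (v - u) = - v by vring.
have e2 : - (v - u) = u - v by vring.
have D w x : H y s x -> H (y - w) s (x - w) by exact: homothetD.
have D0 w : H (y - w) s (- w) by have := D w 0 h0; rewrite sub0r.
have [c1|c1] := leP 1 c.
  have [b1|b1] := leP 1 b; first exact: (improvable_edge uv h0 hu hv b1 c1 hbc).
  have [a1|a1] := leP 1 a.
    apply: (improvable_edge uv1 _ _ _ c1 a1 h1).
    - by rewrite -(subrr u); exact: D.
    - exact: D.
    - exact: D0.
  exfalso; apply: nv.
  have := core_homothetD v (core_vertex _ _ _ _ h2).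
  rewrite subrK add0r; apply.
  - exact: D0.
  - exact: D.
  - lia.
  - lia.
have [b1|b1] := leP 1 b.
  have [a1|a1] := leP 1 a.
    rewrite e1 e2 in uv2; apply: (improvable_edge uv2 _ _ _ a1 b1 h2).
    - by rewrite -(subrr v); exact: D.
    - exact: D0.
    - exact: D.
  exfalso; apply: nu.
  have := core_homothetD u (core_vertex _ _ _ _ h1).
  rewrite subrK add0r; apply.
  - exact: D.
  - exact: D0.
  - lia.
  - lia.
by exfalso; apply: n0; apply: (core_vertex hu hv _ _ hbc); lia.
Qed.
End Flips.

(** * Sliding a homothet across an edge *)

Section Sliding.
Variables (R : realType) (K : set 'cV[R]_2) (s : R).
Hypotheses (cK : convex_set K) (kK : compact K) (s0 : 0 < s).
Implicit Types (u v x y : 'cV[R]_2).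
Local Notation H := (homothet K).
Local Notation fits := (fits K).
Local Notation fits_below := (fits_below K).
Local Notation improvable := (improvable K s).

(** The times in [[0, 1]] at which the moving homothet contains [x] form a compact set. *)
Lemma homothet_last_time y w x : H y s x ->
  exists2 t, 0 <= t <= 1 & H (y + t *: w) s x /\
    forall t', 0 <= t' <= 1 -> H (y + t' *: w) s x -> t' <= t.
Proof.
move=> hx; pose f (t : R) : 'cV[R]_2 := s^-1 *: (x - (y + t *: w)).
have HE t : H (y + t *: w) s x <-> K (f t).
  split=> [[k Kk kE]|Kf].
    suff -> : f t = k by [].
    by rewrite /f -kE addrC addKr scalerA mulVf ?gt_eqF // scale1r.
  by exists (f t) => //; rewrite /f scalerA mulfV ?gt_eqF // scale1r addrC subrK.
have cf : continuous f.
  move=> t; apply: cvgZ; first exact: cvg_cst.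
  apply: cvgB; first exact: cvg_cst.
  by apply: cvgD; [exact: cvg_cst | apply: cvgZ; [exact: cvg_id | exact: cvg_cst]].
have cS : compact (`[0, 1]%classic `&` f @^-1` K).
  apply: compact_closedI; first exact: segment_compact.
  apply: preimage_closed => [t _|]; first exact: cf.
  by apply: compact_closed => //; exact: norm_hausdorff.
have S0 : (`[0, 1]%classic `&` f @^-1` K) !=set0.
  exists 0; split; first by rewrite /= in_itv /= lexx ler01.
  by apply/HE; rewrite scale0r addr0.
have cid : {within `[0, 1]%classic `&` f @^-1` K, continuous (@id R)}.
  by apply: continuous_subspaceT => ?; exact: cvg_id.
have [t /set_mem[/=]] := compact_EVT_max S0 cS cid.
rewrite in_itv /= => t01 Kt tmax; exists t => //; split; first exact/HE.
by move=> t' t'01 /HE Kt'; apply/tmax/mem_set; split; rewrite //= in_itv.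
Qed.

(* Sliding the homothet [y] towards [y'] keeps [u] and [v] inside; stop when [0]
   is about to leave. *)
Lemma improvable_slide y y' u v : lattice_basis u v ->
  (forall y, exists b c : int, core (H y s) (b%:~R *: u + c%:~R *: v)) ->
  ~ fits_below s 0 u v ->
  core (H y s) 0 -> H y s u -> H y s v ->
  H y' s u -> H y' s v -> H y' s (u + v) -> improvable.
Proof.
move=> uv cov nf h0 hu hv hu' hv' huv'.
have [t t01 [ht tmax]] := homothet_last_time (y' - y) (core_sub h0).
set yt := y + t *: (y' - y) in ht.
have mix x : H y s x -> H y' s x -> H yt s x.
  move=> hx hx'; have := homothet_mix cK (ltW s0) (ltW s0) t01 hx hx'.
  rewrite -!mulrDl -!scalerDl !subrK mul1r scale1r; congr homothet.
  by rewrite /yt; vring.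
have htu := mix _ hu hu'; have htv := mix _ hv hv'.
(* An interior [u] would give a smaller homothet through [u] and [v]; as [0] is interior to the
   initial homothet, the triangle would fit below [s]. *)
have nu : ~ core (H yt s) u.
  move=> cu; apply: nf; have [s' ss' /(_ v)[y1 y1v]] := core_chord s0 cu htv.
  rewrite addrC subrK => y1u.
  exact/fits_below_rot/fits_below_rot/(fits_below_core cK ss' hu hv h0 y1u y1v).
have nv : ~ core (H yt s) v.
  move=> cv; apply: nf; have [s' ss' /(_ u)[y1 y1u]] := core_chord s0 cv htu.
  rewrite addrC subrK => y1v.
  exact/fits_below_rot/fits_below_rot/(fits_below_core cK ss' hu hv h0 y1u y1v).
(* If [0] is not interior either, no vertex is, and the interior lattice point lies beyond an edge
   or a vertex. *)
have [ct0|n0] := pselect (core (H yt s) 0); last first.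
  have [b [c hbc]] := cov yt.
  exact: (improvable_triangle cK s0 uv ht htu htv n0 nu nv hbc).
have [t1|t1] := eqVneq t 1.
  have ytE : yt = y' by rewrite /yt t1 scale1r addrC subrK.
  by rewrite ytE in ct0; exact: (improvable_parallelogram0 cK s0 uv ct0 hu' hv' huv').
(* Before the end, an interior [0] would stay inside for a further time [r], against the maximality
   of [t]. *)
have [e e0 he] := ct0 (- (y' - y)).
pose r := Num.min e (1 - t).
have r0 : 0 < r by rewrite lt_min e0 /=; move/andP: t01 t1 => [? ?] ?; lra.
have : H yt s (0 + r *: (- (y' - y))) by apply: he; rewrite gtr0_norm // ge_min lexx.
move=> /(homothetD (r *: (y' - y))).
rewrite add0r scalerN addNr /yt -addrA -scalerDl => htr.
have r1 : r <= 1 - t by rewrite ge_min lexx orbT.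
have := tmax (t + r); case/andP: t01 => t0 _.
have t01 : 0 <= t + r <= 1 by lra.
by move=> /(_ t01 htr); lra.
Qed.

(** The homothet around the opposite triangle, shifted by [u + v], contains the neighbour
    [u, v, u + v] across the edge [[u, v]]: it is the target of the slide. *)
Lemma improvable_vertex y u v : lattice_basis u v ->
  (forall u v y, lattice_basis u v ->
    exists b c : int, core (H y s) (b%:~R *: u + c%:~R *: v)) ->
  ~ fits_below s 0 u v -> fits s 0 (- u) (- v) ->
  core (H y s) 0 -> H y s u -> H y s v -> improvable.
Proof.
move=> uv cov nf [y' [y'0 y'u y'v]] h0 hu hv.
have D := @homothetD _ K y' s _ (u + v).
apply: (@improvable_slide y (y' + (u + v)) u v) => //.
- by move=> z; exact: cov.
- by have := D _ y'v; have -> : - v + (u + v) = u by vring.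
- by have := D _ y'u; rewrite addKr.
- by have := D _ y'0; rewrite add0r.
Qed.

(** If a vertex is interior, it is moved to the origin and the homothet slides over the opposite
    edge; otherwise an interior lattice point decides. *)
Lemma improvable_not_below u v : lattice_basis u v ->
  (forall u v y, lattice_basis u v ->
    exists b c : int, core (H y s) (b%:~R *: u + c%:~R *: v)) ->
  fits s 0 u v -> fits s 0 (- u) (- v) -> ~ fits_below s 0 u v -> improvable.
Proof.
move=> uv cov [y [h0 hu hv]] f nf.
have uv1 := lattice_basis_rot uv; have uv2 := lattice_basis_rot uv1.
have e1 : - u - (v - u) = - v by vring.
have e2 : - (v - u) = u - v by vring.
rewrite e1 e2 in uv2.
have D w x : H y s x -> H (y - w) s (x - w) by exact: homothetD.
have D0 w : H (y - w) s (- w) by have := D w 0 h0; rewrite sub0r.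
have [c0|n0] := pselect (core (H y s) 0).
  exact: (improvable_vertex uv cov nf f c0 hu hv).
have [cu|nu] := pselect (core (H y s) u).
  apply: (@improvable_vertex (y - u) (v - u) (- u)) => //.
  - move=> /(fits_below_translate u); rewrite add0r subrK addNr.
    by move=> /fits_below_rot/fits_below_rot.
  - have := fits_rot (fits_translate u f).
    by rewrite add0r addNr e2 opprK [- v + u]addrC.
  - by rewrite -(subrr u); exact: core_homothetD.
  - exact: D.
have [cv|nv] := pselect (core (H y s) v).
  apply: (@improvable_vertex (y - v) (- v) (u - v)) => //.
  - move=> /(fits_below_translate v); rewrite add0r subrK addNr.
    by move=> /fits_below_rot.
  - have := fits_rot (fits_rot (fits_translate v f)).
    by rewrite add0r addNr opprK opprB [- u + v]addrC.
  - by rewrite -(subrr v); exact: core_homothetD.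
  - exact: D.
have [b [c hbc]] := cov u v y uv.
exact: (improvable_triangle cK s0 uv h0 hu hv n0 nu nv hbc).
Qed.

Lemma improvable_covering u v : lattice_basis u v ->
  (forall u v y, lattice_basis u v ->
    exists b c : int, core (H y s) (b%:~R *: u + c%:~R *: v)) ->
  fits s 0 u v -> fits s 0 (- u) (- v) -> improvable.
Proof.
move=> uv cov f1 f2.
have [b1|n1] := pselect (fits_below s 0 u v); last first.
  exact: (improvable_not_below uv cov).
have [b2|n2] := pselect (fits_below s 0 (- u) (- v)); first by exists u, v.
apply: (improvable_not_below (lattice_basisN uv) cov) => //.
by rewrite !opprK.
Qed.
End Sliding.

(** * Coverings by lattice translates *)

Lemma cV2P (R : nmodType) (x y : 'cV[R]_2) : x 0 0 = y 0 0 -> x 1 0 = y 1 0 -> x = y.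
Proof.
move=> h0 h1; apply/matrixP => i j; rewrite (ord1 j).
have /orP[/eqP->|/eqP->] // : (i == 0) || (i == 1) by case: i => [[|[|]]].
Qed.

Definition covers (R : realType) (K : set 'cV[R]_2) (m : R) : Prop :=
  minkowski_sum (dilate m K) (@integer_lattice R 2) = setT.

Lemma coversP (R : realType) (K : set 'cV[R]_2) (m : R) :
  covers K m <-> forall x, exists2 k, K k & @integer_lattice R 2 (x - m *: k).
Proof.
split=> [cov x|cov].
  have : [set: 'cV[R]_2] x by [].
  rewrite -cov => -[_ [k Kk <-] [z Zz <-]]; exists k => //.
  by rewrite addrC addKr.
apply/seteqP; split=> // x _; have [k Kk Zk] := cov x.
by exists (m *: k); [exists k|exists (x - m *: k) => //; rewrite addrC subrK].
Qed.

Lemma integer_latticeN (R : realType) (x : 'cV[R]_2) :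
  @integer_lattice R 2 x -> @integer_lattice R 2 (- x).
Proof. by move=> [z _ <-]; exists (- z) => //; rewrite map_mxN. Qed.

Lemma uncountable_real (R : realType) : ~ countable [set: R].
Proof.
move=> cR.
have c01 := sub_countable (subset_card_le (@subsetT R `[0, 1]%classic)) cR.
have := countable_lebesgue_measure0 c01.
rewrite lebesgue_measure_itv /= lte01 oppr0 adde0.
by move/eqP; rewrite eqe oner_eq0.
Qed.

(** The functional [(p, q)] sends the translates of [m *: K] to the countable set of the numbers
    [m r + p a + q b] with integers [a], [b], but a nonzero functional is onto the reals. *)
Lemma covers_not_on_line (R : realType) (K : set 'cV[R]_2) (m p q r : R) :
  covers K m -> (forall k, K k -> p * k 0 0 + q * k 1 0 = r) -> p = 0 /\ q = 0.
Proof.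
move=> /coversP cov line; apply: contrapT => pq0.
have [w ww0] : exists w : 'cV[R]_2, p * w 0 0 + q * w 1 0 != 0.
  have [p0|p0] := eqVneq p 0.
    exists (\col_i (i == 1)%:R); rewrite !mxE p0 /= mul0r add0r mulr1.
    by apply/eqP => q0; apply: pq0.
  by exists (\col_i (i == 0)%:R); rewrite !mxE /= mulr1 mulr0 addr0.
apply: (@uncountable_real R).
pose F (z : 'cV[int]_2) := m * r + p * (z 0 0)%:~R + q * (z 1 0)%:~R.
apply: (@sub_countable _ _ _ (range F)); last first.
  exact: (sub_countable (card_image_le _ _) (countableP _)).
apply: subset_card_le => x _.
have [k Kk [z _ zE]] := cov ((x / (p * w 0 0 + q * w 1 0)) *: w).
exists z => //; rewrite /F -(line k Kk).
have := congr1 (fun u : 'cV[R]_2 => u 0 0) zE.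
have := congr1 (fun u : 'cV[R]_2 => u 1 0) zE.
by rewrite !mxE => -> ->; field.
Qed.

Lemma core_of_triangle (R : realType) (K : set 'cV[R]_2) k1 k2 k3 :
  convex_set K -> K k1 -> K k2 -> K k3 ->
  (k2 - k1) 0 0 * (k3 - k1) 1 0 != (k2 - k1) 1 0 * (k3 - k1) 0 0 ->
  core K !=set0.
Proof.
move=> cK K1 K2 K3; rewrite -subr_eq0 => D0.
pose D := (k2 - k1) 0 0 * (k3 - k1) 1 0 - (k2 - k1) 1 0 * (k3 - k1) 0 0.
(* At the barycentre all weights are [1/3]. Cramer's rule writes [d] in the edge directions, and the
   step is small enough to change each weight by at most [1/3]. *)
exists (3^-1 *: k1 + 3^-1 *: k2 + 3^-1 *: k3) => d.
pose b := (d 0 0 * (k3 - k1) 1 0 - d 1 0 * (k3 - k1) 0 0) / D.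
pose c := ((k2 - k1) 0 0 * d 1 0 - (k2 - k1) 1 0 * d 0 0) / D.
have dE : d = b *: (k2 - k1) + c *: (k3 - k1).
  by apply: cV2P; rewrite /b /c /D; move: D0; rewrite !mxE => D0; field.
have e0 : 0 < 3 * (1 + `|b| + `|c|).
  by have := normr_ge0 b; have := normr_ge0 c; lra.
exists (3 * (1 + `|b| + `|c|))^-1; first by rewrite invr_gt0.
move=> t te; rewrite dE.
have : `|t * b| + `|t * c| <= 3^-1.
  rewrite (normrM t b) (normrM t c) -mulrDr.
  apply: (@le_trans _ _ ((3 * (1 + `|b| + `|c|))^-1 * (`|b| + `|c|))).
    by apply: ler_wpM2r => //; rewrite addr_ge0.
  rewrite ler_pdivrMl //.
  by have := normr_ge0 b; have := normr_ge0 c; lra.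
have := ler_norm (t * b); have := ler_norm (t * c).
have := ler_norm (- (t * b)); have := ler_norm (- (t * c)); rewrite !normrN.
move=> h1 h2 h3 h4 h5.
have := convex_set_combine3 (a := 3^-1 - t * b - t * c) (b := 3^-1 + t * b)
  (c := 3^-1 + t * c) cK K1 K2 K3.
suff -> : 3^-1 *: k1 + 3^-1 *: k2 + 3^-1 *: k3 +
    t *: (b *: (k2 - k1) + c *: (k3 - k1)) =
  (3^-1 - t * b - t * c) *: k1 + (3^-1 + t * b) *: k2 + (3^-1 + t * c) *: k3.
  by apply; lra.
by vring.
Qed.

(** Without a non-degenerate triangle, [K] is a point or lies on a line, and then it cannot
    cover. *)
Lemma covers_core (R : realType) (K : set 'cV[R]_2) (m : R) :
  convex_set K -> covers K m -> core K !=set0.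
Proof.
move=> cK cov; apply: contrapT => ncore.
have [k1 Kk1 _] := (coversP _ _).1 cov 0.
have col k2 k3 : K k2 -> K k3 ->
    (k2 - k1) 0 0 * (k3 - k1) 1 0 = (k2 - k1) 1 0 * (k3 - k1) 0 0.
  move=> K2 K3; apply/eqP/negPn/negP => D0; apply: ncore.
  exact: core_of_triangle D0.
have [[k2 [Kk2 k21]]|none] := pselect (exists k2, K k2 /\ k2 <> k1).
  apply: k21.
  have [] := @covers_not_on_line R K m (- (k2 - k1) 1 0) ((k2 - k1) 0 0)
    (- (k2 - k1) 1 0 * k1 0 0 + (k2 - k1) 0 0 * k1 1 0) cov.
    by move=> k Kk; have := col _ _ Kk2 Kk; rewrite !mxE; lra.
  by rewrite !mxE => h1 h0; apply: cV2P; lra.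
have [] := @covers_not_on_line R K m 1 0 (k1 0 0) cov.
  move=> k Kk; have -> : k = k1 by apply: contrapT => kk; apply: none; exists k.
  by rewrite mul1r mul0r addr0.
by move=> /eqP; rewrite oner_eq0.
Qed.

(** * The optimal lattice basis *)

Lemma core_homothet (R : realType) (K : set 'cV[R]_2) y s k : 0 < s ->
  core K k -> core (homothet K y s) (y + s *: k).
Proof.
move=> s0 ck d; have [e e0 he] := ck d; exists (e * s) => [|t te].
  exact: mulr_gt0.
exists (k + (t / s) *: d); last by vfield; rewrite gt_eqF.
by apply: he; rewrite normrM normfV (gtr0_norm s0) ler_pdivrMr.
Qed.

(** Split [s K] into [m K] and [(s - m) K]: an interior point [k0] serves for the second part, and
    the covering by [m K] corrects the sum to a lattice point. *)
Lemma covers_core_homothet (R : realType) (K : set 'cV[R]_2) m s u v y :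
  convex_set K -> covers K m -> 0 <= m < s -> lattice_basis u v ->
  exists b c : int, core (homothet K y s) (b%:~R *: u + c%:~R *: v).
Proof.
move=> cK cov /andP[m0 ms] uv; have [k0 ck0] := covers_core cK cov.
have [k Kk /integer_latticeN Zk] := (coversP _ _).1 cov (- (y + (s - m) *: k0)).
have [b [c bcE]] := lattice_basis_span uv Zk; exists b, c; rewrite -bcE.
have s0 : 0 < s by lra.
have -> : - (- (y + (s - m) *: k0) - m *: k) =
    y + s *: (((s - m) / s) *: k0 + (m / s) *: k).
  by vfield; rewrite gt_eqF.
apply: core_homothet => //; apply: core_combine => //.
- by rewrite divr_gt0 // subr_gt0.
- by rewrite divr_ge0 // ltW.
- by field; rewrite gt_eqF.
Qed.

Lemma fits_exists (R : realType) (K : set 'cV[R]_2) u v : core K !=set0 ->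
  exists2 s, 0 <= s & fits K s 0 u v.
Proof.
move=> [k ck]; have [e e0 he] := ck u; have [f f0 hf] := ck v.
pose r := Num.min e f; have r0 : 0 < r by rewrite lt_min e0 f0.
have rN0 : r != 0 by rewrite gt_eqF.
exists r^-1; first by rewrite invr_ge0 ltW.
exists (- (r^-1 *: k)); split.
- by exists k; [exact: core_sub|rewrite addNr].
- exists (k + r *: u); last by vfield.
  by apply: he; rewrite gtr0_norm // ge_min lexx.
- exists (k + r *: v); last by vfield.
  by apply: hf; rewrite gtr0_norm // ge_min lexx orbT.
Qed.

(** Without the translation [y], the unknowns range over the compact set [K], as minimisation
    requires. *)
Lemma fitsP (R : realType) (K : set 'cV[R]_2) s u v :
  fits K s 0 u v <-> exists k0 k1 k2, [/\ K k0, K k1, K k2,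
    s *: (k1 - k0) = u & s *: (k2 - k0) = v].
Proof.
split=> [[y [[k0 K0 e0] [k1 K1 e1] [k2 K2 e2]]]|[k0 [k1 [k2 [K0 K1 K2 <- <-]]]]].
  exists k0, k1, k2; split => //.
  - by rewrite -e1 -[LHS]add0r -{1}e0; vring.
  - by rewrite -e2 -[LHS]add0r -{1}e0; vring.
exists (- (s *: k0)).
by split; [exists k0 => //|exists k1 => //|exists k2 => //]; vring.
Qed.

Lemma fits_min (R : realType) (K : set 'cV[R]_2) s u v : compact K ->
  0 <= s -> fits K s 0 u v -> exists t, [/\ 0 <= t, fits K t 0 u v &
    forall r, 0 <= r -> fits K r 0 u v -> t <= r].
Proof.
move=> kK s0 /fitsP[l0 [l1 [l2 [L0 L1 L2 E1 E2]]]].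
pose f (p : R * ('cV[R]_2 * ('cV[R]_2 * 'cV[R]_2))) :=
  p.1 *: (p.2.2.1 - p.2.1).
pose g (p : R * ('cV[R]_2 * ('cV[R]_2 * 'cV[R]_2))) :=
  p.1 *: (p.2.2.2 - p.2.1).
have c1 (p : R * ('cV[R]_2 * ('cV[R]_2 * 'cV[R]_2))) :
    q.1 @[q --> p] --> p.1 by exact: cvg_fst.
have c2 (p : R * ('cV[R]_2 * ('cV[R]_2 * 'cV[R]_2))) : q.2.1 @[q --> p] --> p.2.1.
  by apply: (@cvg_comp _ _ _ (fun q => q.2) (fun q => q.1) _ _ _ cvg_snd cvg_fst).
have c0 (p : R * ('cV[R]_2 * ('cV[R]_2 * 'cV[R]_2))) : q.2.2 @[q --> p] --> p.2.2.
  exact: (@cvg_comp _ _ _ (fun q => q.2) (fun q => q.2) _ _ _ cvg_snd cvg_snd).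
have c3 (p : R * ('cV[R]_2 * ('cV[R]_2 * 'cV[R]_2))) : q.2.2.1 @[q --> p] --> p.2.2.1.
  exact: (@cvg_comp _ _ _ (fun q => q.2.2) (fun q => q.1) _ _ _ (c0 p) cvg_fst).
have c4 (p : R * ('cV[R]_2 * ('cV[R]_2 * 'cV[R]_2))) : q.2.2.2 @[q --> p] --> p.2.2.2.
  exact: (@cvg_comp _ _ _ (fun q => q.2.2) (fun q => q.2) _ _ _ (c0 p) cvg_snd).
have cf : continuous f by move=> p; exact: (cvgZ (c1 p) (cvgB (c3 p) (c2 p))).
have cg : continuous g by move=> p; exact: (cvgZ (c1 p) (cvgB (c4 p) (c2 p))).
pose A := (`[0, s]%classic `*` (K `*` (K `*` K))) `&`
   f @^-1` [set u] `&` g @^-1` [set v].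
have cA : compact A.
  have cl1 (w : 'cV[R]_2) : closed [set w].
    by apply: accessible_closed_set1; apply: hausdorff_accessible;
      exact: norm_hausdorff.
  apply: compact_closedI; last by apply: preimage_closed => // ? _; exact: cg.
  apply: compact_closedI; last by apply: preimage_closed => // ? _; exact: cf.
  apply: compact_setX; first exact: segment_compact.
  by apply: compact_setX => //; apply: compact_setX.
have A0 : A !=set0.
  exists (s, (l0, (l1, l2))); split=> //; split=> //; split=> //=.
  by rewrite in_itv /= s0 lexx.
have cfst : {within A, continuous (fun p => p.1 : R)}.
  by apply: continuous_subspaceT => p; exact: c1.
have [[t [k0 [k1 k2]]] /set_mem[[[/=]]]] := compact_EVT_min A0 cA cfst.
rewrite in_itv /= => /andP[t0 ts] [K0 [K1 K2]] ft gt tmin.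
exists t; split => //; first by apply/fitsP; exists k0, k1, k2.
move=> r r0 /fitsP[m0 [m1 [m2 [M0 M1 M2 F1 F2]]]].
have [rs|/ltW/(le_trans ts)//] := leP r s.
apply: (tmin (r, (m0, (m1, m2)))); apply/mem_set; split=> //; split=> //; split=> //=.
by rewrite in_itv /= r0.
Qed.

Lemma fits_both_min (R : realType) (K : set 'cV[R]_2) u v :
  convex_set K -> compact K -> core K !=set0 ->
  exists t, [/\ 0 <= t, fits K t 0 u v, fits K t 0 (- u) (- v) &
    forall r, 0 <= r -> fits K r 0 u v -> fits K r 0 (- u) (- v) -> t <= r].
Proof.
move=> cK kK core0.
have K0 : K !=set0 by case: core0 => k /core_sub Kk; exists k.
have [s1 s10 f1] := fits_exists u v core0.
have [s2 s20 f2] := fits_exists (- u) (- v) core0.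
have [t1 [t10 g1 m1]] := fits_min kK s10 f1.
have [t2 [t20 g2 m2]] := fits_min kK s20 f2.
(* Fitting is monotone in the size, so the larger minimum serves both triangles. *)
exists (Num.max t1 t2); split.
- by rewrite le_max t10.
- by apply: fits_grow g1 => //; rewrite t10 le_max lexx.
- by apply: fits_grow g2 => //; rewrite t20 le_max lexx orbT.
- by move=> r r0 h1 h2; rewrite ge_max m1 ?m2.
Qed.

Lemma compact_coord_bounded (R : realType) (K : set 'cV[R]_2) : compact K ->
  exists M, forall k i j, K k -> `|k i j| <= M.
Proof.
move=> /compact_bounded[M [_ hM]]; exists (M + 1) => k i j Kk.
have M1 : M < M + 1 by rewrite ltrDl.
apply: le_trans (hM _ M1 k Kk).
rewrite [leRHS]/Num.norm /= mx_normrE.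
by apply/bigmax_geP; right; exists (i, j).
Qed.

(** Only finitely many integer matrices have entries bounded by [B], and all competitors of [g0] are
    among them. *)
Lemma int_matrix_argmin (R : realType) (P : pred 'M[int]_2)
    (S : 'M[int]_2 -> R) g0 (B : R) :
  P g0 -> (forall g, P g -> S g <= S g0 -> forall i j, `|(g i j)%:~R| <= B) ->
  exists2 g, P g & forall h, P h -> S g <= S h.
Proof.
move=> Pg0 bound.
pose N := (Num.truncn B).+1.
have BN (z : int) : `|z%:~R| <= B -> (`|z| < N)%N.
  move=> zB; have := le_lt_trans zB (truncnS_gt B).
  by rewrite -intr_norm pmulrn ltr_int -abszE ltz_nat.
(* Ordinals below [2 N], shifted by [N], encode the integers from [- N] to [N - 1]. *)
pose dec (h : 'M['I_(N + N)]_2) : 'M[int]_2 := \matrix_(i, j) ((h i j)%:Z - N%:Z).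
have decP (g : 'M[int]_2) : (forall i j, `|(g i j)%:~R| <= B) -> exists h, g = dec h.
  move=> gB; have Np : (0 < N + N)%N by [].
  exists (\matrix_(i, j) insubd (Ordinal Np) (absz (g i j + N%:Z))).
  apply/matrixP => i j; rewrite !mxE val_insubd.
  have := BN _ (gB i j) => gN.
  by case: ifP; lia.
have [h0 h0E] : exists h, g0 = dec h by apply: decP; exact: bound.
rewrite h0E in Pg0 bound *.
case: (@arg_minP _ _ _ h0 (fun h => P (dec h)) (fun h => S (dec h)) Pg0).
move=> h Ph hmin; exists (dec h) => // g Pg.
have [le|/ltW] := leP (S g) (S (dec h0)).
  by have [h' h'E] := decP g (bound g Pg le); rewrite h'E in Pg *; exact: hmin.
by apply: le_trans; exact: hmin.
Qed.

Definition real_col (R : realType) (g : 'M[int]_2) (j : 'I_2) : 'cV[R]_2 :=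
  map_mx intr (col j g).

Lemma optimal_basis (R : realType) (K : set 'cV[R]_2) m :
  convex_set K -> compact K -> 0 <= m -> covers K m ->
  exists g : 'M[int]_2, exists S : R, [/\ g \in unitmx, 0 < S,
    fits K S 0 (real_col R g 0) (real_col R g 1),
    fits K S 0 (- real_col R g 0) (- real_col R g 1) &
    forall m', 0 <= m' -> covers K m' -> S <= m'].
Proof.
move=> cK kK m0 cov.
have core0 := covers_core cK cov.
have K0 : K !=set0 by case: core0 => k /core_sub Kk; exists k.
have /choice[S HS] g := fits_both_min (real_col R g 0) (real_col R g 1) cK kK core0.
have [M HM] := compact_coord_bounded kK.
have [g gU gmin] : exists2 g, g \in unitmx & forall h, h \in unitmx -> S g <= S h.
  apply: (@int_matrix_argmin R _ S 1%:M (S 1%:M * (M + M))); first exact: unitmx1.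
  move=> g gU le i j; have [Sg0 f _ _] := HS g.
  have M0 : 0 <= M by have [k Kk] := K0; apply: le_trans (HM k 0 0 Kk).
  (* Each column is [S g] times a difference of two points of [K]. *)
  have entry (k k' : 'cV[R]_2) (x : 'cV[R]_2) : K k -> K k' -> S g *: (k' - k) = x ->
      `|x i 0| <= S 1%:M * (M + M).
    move=> Kk Kk' <-; rewrite !mxE normrM ger0_norm //.
    apply: ler_pM => //; apply: le_trans (ler_normB _ _) _.
    by apply: lerD; exact: HM.
  have [k0 [k1 [k2 [K0' K1 K2 E1 E2]]]] := (fitsP _ _ _ _).1 f.
  have /orP[/eqP->|/eqP->] : (j == 0) || (j == 1) by case: j => [[|[|]]].
  - by have := entry _ _ _ K0' K1 E1; rewrite !mxE.
  - by have := entry _ _ _ K0' K2 E2; rewrite !mxE.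
have [Sg0 f1 f2 fmin] := HS g.
have gB : lattice_basis (real_col R g 0) (real_col R g 1) by exists g.
exists g, (S g); split => //.
  (* Size [0] would make both basis vectors vanish, yet they generate the all-ones vector. *)
  rewrite lt_def Sg0 andbT; apply/eqP => S0.
  have [k0 [k1 [k2 [_ _ _ E1 E2]]]] := (fitsP _ _ _ _).1 f1.
  move: gB; rewrite -E1 -E2 S0 !scale0r => gB.
  have Zx : @integer_lattice R 2 (const_mx 1)
    by exists (const_mx 1) => //; rewrite map_const_mx.
  have [b [c]] := lattice_basis_span gB Zx.
  rewrite !scaler0 addr0 => /matrixP/(_ 0 0)/eqP.
  by rewrite !mxE oner_eq0.
move=> m' m'0 cov'; rewrite leNgt; apply/negP => lt.
have Sp : 0 < S g by exact: le_lt_trans lt.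
have m'S : 0 <= m' < S g by rewrite m'0.
have [] := @improvable_covering R K (S g) cK kK Sp _ _ gB _ f1 f2.
  by move=> u v y uv; exact: (covers_core_homothet y cK cov' m'S uv).
move=> _ [_ [[h hU [-> ->]] [s1 /andP[s10 s1S] h1] [s2 /andP[s20 s2S] h2]]].
have [_ _ _ hmin] := HS h.
have : S h <= Num.max s1 s2.
  apply: hmin.
  - by rewrite le_max s10.
  - by apply: fits_grow h1 => //; rewrite s10 le_max lexx.
  - by apply: fits_grow h2 => //; rewrite s20 le_max lexx orbT.
rewrite leNgt gt_max (lt_le_trans s1S) ?(lt_le_trans s2S) //; exact: gmin.
Qed.

(** * Two opposite lattice triangles cover the plane *)

(** Interpolating two unit chords in direction [d] gives a unit chord at each height in between; at
    an integral height it contains a lattice point. *)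
Lemma convex_chord_integral (R : realType) (K : set 'cV[R]_2)
    (d f : 'cV[R]_2) p1 p2 q1 q2 (n : int) :
  convex_set K ->
  K (p1 *: d + p2 *: f) -> K ((p1 + 1) *: d + p2 *: f) ->
  K (q1 *: d + q2 *: f) -> K ((q1 + 1) *: d + q2 *: f) ->
  p2 <= n%:~R <= q2 -> exists i : int, K (i%:~R *: d + n%:~R *: f).
Proof.
move=> cK Kp Kp' Kq Kq'; move: n%:~R => {}n /andP[pn nq].
have [t /andP[t0 t1] nE] : exists2 t, 0 <= t <= 1 & n = (1 - t) * p2 + t * q2.
  have [pq|pq] := eqVneq p2 q2; first by exists 0; [rewrite lexx ler01|lra].
  have qp : 0 < q2 - p2 by rewrite subr_gt0 lt_neqAle pq (le_trans pn).
  exists ((n - p2) / (q2 - p2)); last by field; rewrite gt_eqF.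
  by apply/andP; split; [rewrite divr_ge0; lra|rewrite ler_pdivrMr; lra].
pose r := (1 - t) * p1 + t * q1.
have Kr : K (r *: d + n *: f).
  have := convex_set_combine (a := 1 - t) (b := t) cK Kp Kq.
  suff -> : (1 - t) *: (p1 *: d + p2 *: f) + t *: (q1 *: d + q2 *: f) = r *: d + n *: f.
    by apply; lra.
  by rewrite nE /r; vring.
have Kr' : K ((r + 1) *: d + n *: f).
  have := convex_set_combine (a := 1 - t) (b := t) cK Kp' Kq'.
  suff -> : (1 - t) *: ((p1 + 1) *: d + p2 *: f) + t *: ((q1 + 1) *: d + q2 *: f) =
      (r + 1) *: d + n *: f by apply; lra.
  by rewrite nE /r; vring.
exists (Num.floor r + 1).
have := floor_itv r; rewrite !rmorphD /=; move: (Num.floor r)%:~R => z /andP[zr rz].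
have := convex_set_combine (a := r - z) (b := z + 1 - r) cK Kr Kr'.
suff -> : (r - z) *: (r *: d + n *: f) + (z + 1 - r) *: ((r + 1) *: d + n *: f) =
      (z + 1) *: d + n *: f by apply; lra.
by vring.
Qed.

(* Chords of length one in the directions [u], [v] and [u - v] provide the lattice
   point unless [p] and [q] lie in the same cell of the lattice; there, one of the
   two triangles contains a corner of the cell or the diagonal [u - v] works. *)
Lemma convex_triangles_integral (R : realType) (K : set 'cV[R]_2) u v p1 p2 q1 q2 :
  convex_set K ->
  let p := p1 *: u + p2 *: v in let q := q1 *: u + q2 *: v in
  K p -> K (p + u) -> K (p + v) -> K q -> K (q - u) -> K (q - v) ->
  exists i j : int, K (i%:~R *: u + j%:~R *: v).
Proof.
move=> cK p q Kp Kpu Kpv Kq Kqu Kqv.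
have /andP[a1 a2] := floor_itv p1; have /andP[b1 b2] := floor_itv p2.
set a := Num.floor p1 in a1 a2; set b := Num.floor p2 in b1 b2.
rewrite !rmorphD /= in a2 b2.
have E x y : x = y -> K x -> K y by move=> ->.
have Kpu1 : K ((p1 + 1) *: u + p2 *: v) by apply: E Kpu; rewrite /p; vring.
have Kpv1 : K (p1 *: u + (p2 + 1) *: v) by apply: E Kpv; rewrite /p; vring.
have Kqu1 : K ((q1 - 1) *: u + q2 *: v) by apply: E Kqu; rewrite /q; vring.
have Kqv1 : K (q1 *: u + (q2 - 1) *: v) by apply: E Kqv; rewrite /q; vring.
have hor (n : int) : p2 <= n%:~R <= q2 \/ q2 <= n%:~R <= p2 ->
    exists i j : int, K (i%:~R *: u + j%:~R *: v).
  have Kq1 : K ((q1 - 1 + 1) *: u + q2 *: v) by rewrite subrK.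
  case=> h.
  - by have [i] := convex_chord_integral cK Kp Kpu1 Kqu1 Kq1 h; exists i, n.
  - by have [i] := convex_chord_integral cK Kqu1 Kq1 Kp Kpu1 h; exists i, n.
have ver (n : int) : p1 <= n%:~R <= q1 \/ q1 <= n%:~R <= p1 ->
    exists i j : int, K (i%:~R *: u + j%:~R *: v).
  move: Kp Kpv1 Kqv1; rewrite /p ![_ *: u + _]addrC => Kp' Kpv' Kqv'.
  have Kq1 : K ((q2 - 1 + 1) *: v + q1 *: u) by rewrite subrK addrC.
  case=> h.
  - by have [i] := convex_chord_integral cK Kp' Kpv' Kqv' Kq1 h;
      exists n, i; rewrite addrC.
  - by have [i] := convex_chord_integral cK Kqv' Kq1 Kp' Kpv' h;
      exists n, i; rewrite addrC.
(* If [q] is not strictly inside the strips of the cell of [p], a side line of that cell gives the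
   integral height. *)
have [qb|qb] := leP q2 b%:~R; first by apply: (hor b); right; rewrite qb.
have [qb'|qb'] := leP (b%:~R + 1) q2.
  by apply: (hor (b + 1)); left; rewrite rmorphD /= qb' ltW.
have [qa|qa] := leP q1 a%:~R; first by apply: (ver a); right; rewrite qa.
have [qa'|qa'] := leP (a%:~R + 1) q1.
  by apply: (ver (a + 1)); left; rewrite rmorphD /= qa' ltW.
(* The upper corner of the cell lies in the triangle at [p], or the lower corner in the triangle at
   [q], according to the side of the diagonal. *)
have [pab|pab] := leP (a%:~R + b%:~R + 1) (p1 + p2).
  exists (a + 1), (b + 1); rewrite !rmorphD /=.
  have := convex_set_combine3 (a := p1 + p2 - a%:~R - b%:~R - 1)
    (b := a%:~R + 1 - p1) (c := b%:~R + 1 - p2) cK Kp Kpu1 Kpv1.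
  by move=> h; apply: (E _ _ _ (h _ _ _ _)); first [rewrite /p; vring | lra].
have [qab|qab] := leP (q1 + q2) (a%:~R + b%:~R + 1).
  exists a, b.
  have := convex_set_combine3 (a := a%:~R + b%:~R + 1 - q1 - q2)
    (b := q1 - a%:~R) (c := q2 - b%:~R) cK Kq Kqu1 Kqv1.
  by move=> h; apply: (E _ _ _ (h _ _ _ _)); first [rewrite /q; vring | lra].
(* In the basis [(u - v, v)] the height is the sum of the coordinates; the chords are the edges
   opposite to [q] and to [p]. *)
have [i] : exists i : int, K (i%:~R *: (u - v) + (a + b + 1)%:~R *: v).
  apply: (@convex_chord_integral R K _ _ (q1 - 1) (q1 + q2 - 1)
    p1 (p1 + p2 + 1) (a + b + 1)) => //.
  - by apply: E Kqu1; vring.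
  - by apply: E Kqv1; vring.
  - by apply: E Kpv1; vring.
  - by apply: E Kpu1; vring.
  - by rewrite !rmorphD /=; lra.
move=> Ki; exists i, (a + b + 1 - i); apply: E Ki; rewrite rmorphB /=; vring.
Qed.

(** Scaling the triangle rather than the body makes the scale additive under Minkowski combinations
    and allows [s = 0]. *)
Definition contains_triangle (R : realType) (K : set 'cV[R]_2) (s : R)
    (u v : 'cV[R]_2) : Prop :=
  exists p, [/\ K p, K (p + s *: u) & K (p + s *: v)].

Lemma fits_contains_triangle (R : realType) (K : set 'cV[R]_2) s u v :
  0 < s -> fits K s 0 u v -> contains_triangle K s^-1 u v.
Proof.
move=> s0 /fitsP[k0 [k1 [k2 [K0 K1 K2 <- <-]]]].
exists k0; rewrite !scalerA mulVf ?gt_eqF // !scale1r.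
by split=> //; rewrite addrC subrK.
Qed.

Lemma lattice_basis_coord (R : realType) (u v x : 'cV[R]_2) : lattice_basis u v ->
  exists b c : R, x = b *: u + c *: v.
Proof.
move=> [g gU [-> ->]].
have [w ->] : exists w : 'cV[R]_2, x = map_mx intr g *m w.
  by exists (map_mx intr (invmx g) *m x);
    rewrite mulmxA -map_mxM mulmxV // map_mx1 mul1mx.
exists (w 0 0), (w 1 0).
apply/matrixP => i j; rewrite !mxE !big_ord_recl big_ord0 addr0 !mxE (ord1 j).
rewrite [RHS]addrC [w _ _ * _]mulrC [w _ _ * _]mulrC addrC.
by congr (_%:~R * _ + _%:~R * _); congr (fun_of_matrix _ _ _); apply/val_inj.
Qed.

Lemma contains_triangles_covers (R : realType) (K : set 'cV[R]_2) s u v :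
  convex_set K -> lattice_basis u v -> 0 < s ->
  contains_triangle K s u v -> contains_triangle K s (- u) (- v) -> covers K s^-1.
Proof.
move=> cK uv s0 [p [Kp Kpu Kpv]] [q [Kq Kqu Kqv]]; apply/coversP => x.
(* This is [s^-1 *: K] shifted by [- x]; a lattice point in it shows that [x] is covered. *)
pose C : set 'cV[R]_2 := [set z | K (s *: (x + z))].
have cC : convex_set C.
  apply: convex_setP => y z a b Cy Cz a0 b0 ab.
  have := convex_set_combine cK Cy Cz a0 b0 ab.
  suff -> : a *: (s *: (x + y)) + b *: (s *: (x + z)) =
      s *: (x + (a *: y + b *: z)) by [].
  have -> : b = 1 - a by lra.
  by vring.
have CE w y : K y -> y = s *: (x + w) -> C w by move=> Ky yE; rewrite /C /= -yE.
have s1 : s != 0 by rewrite gt_eqF.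
have [p1 [p2 pE]] := lattice_basis_coord (s^-1 *: p - x) uv.
have [q1 [q2 qE]] := lattice_basis_coord (s^-1 *: q - x) uv.
have [||||||i [j Cij]] := @convex_triangles_integral R C u v p1 p2 q1 q2 cC.
- by rewrite -pE; apply: (CE _ _ Kp); vfield.
- by rewrite -pE; apply: (CE _ _ Kpu); vfield.
- by rewrite -pE; apply: (CE _ _ Kpv); vfield.
- by rewrite -qE; apply: (CE _ _ Kq); vfield.
- by rewrite -qE; apply: (CE _ _ Kqu); vfield.
- by rewrite -qE; apply: (CE _ _ Kqv); vfield.
exists (s *: (x + (i%:~R *: u + j%:~R *: v))) => //.
rewrite scalerA mulVf // scale1r opprD addrA subrr add0r.
exact/integer_latticeN/lattice_basis_comb.
Qed.

(** * Covering radii of Minkowski combinations *)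

Lemma covering_radius_ge0 (R : realType) (K : set 'cV[R]_2) :
  (0 <= covering_radius K)%E.
Proof. by apply: le_ereal_inf_tmp => _ [m [m0 _] <-]; rewrite lee_fin. Qed.

(* The scale [s] is [0] when no dilate of [K] covers. *)
Lemma covering_triangles (R : realType) (K : set 'cV[R]_2) : convex_body K ->
  exists g : 'M[int]_2, exists s : R, [/\ g \in unitmx, 0 <= s,
    contains_triangle K s (real_col R g 0) (real_col R g 1),
    contains_triangle K s (- real_col R g 0) (- real_col R g 1) &
    ((covering_radius K)^-1 <= s%:E)%E].
Proof.
move=> [[k Kk] kK cK].
have [[m [m0 cov]]|none] := pselect (exists m, 0 <= m /\ covers K m).
  have [g [S [gU S0 f1 f2 Smin]]] := optimal_basis cK kK m0 cov.
  exists g, S^-1; split => //.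
  - by rewrite invr_ge0 ltW.
  - exact: fits_contains_triangle.
  - exact: fits_contains_triangle.
  have -> : (S^-1%:E = (S%:E)^-1)%E by rewrite inver gt_eqF.
  rewrite lee_pV2.
  - by apply: le_ereal_inf_tmp => _ [m' [m'0 cov'] <-]; rewrite lee_fin; exact: Smin.
  - by rewrite inE covering_radius_ge0.
  - by rewrite inE lee_fin ltW.
exists 1%:M, 0; split; rewrite ?unitmx1 //.
- by exists k; rewrite !scale0r addr0; split.
- by exists k; rewrite !scale0r addr0; split.
have A0 : [set m%:E | m in [set m : R | 0 <= m /\ covers K m]] = set0.
  by apply/seteqP; split=> // x [m' [m'0 cov'] _]; apply: none; exists m'.
by rewrite /covering_radius A0 ereal_inf0 invey.
Qed.

Lemma contains_triangle_combine (R : realType) (K1 K2 : set 'cV[R]_2) (g : 'M[int]_2)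
    (s1 s2 l : R) u v u' v' :
  contains_triangle K1 s1 u v -> contains_triangle K2 s2 u' v' ->
  map_mx intr g *m u' = u -> map_mx intr g *m v' = v ->
  contains_triangle
    (minkowski_sum (dilate (1 - l) K1) (int_image g (dilate l K2)))
    ((1 - l) * s1 + l * s2) u v.
Proof.
move=> [p [Kp Kpu Kpv]] [q [Kq Kqu Kqv]] gu gv.
have mem x y : K1 x -> K2 y ->
    minkowski_sum (dilate (1 - l) K1) (int_image g (dilate l K2))
      ((1 - l) *: x + map_mx intr g *m (l *: y)).
  move=> K1x K2y; exists ((1 - l) *: x); first by exists x.
  by exists (map_mx intr g *m (l *: y)) => //; exists (l *: y) => //; exists y.
exists ((1 - l) *: p + map_mx intr g *m (l *: q)); split.
- exact: mem.
- have := mem _ _ Kpu Kqu; congr minkowski_sum.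
  rewrite !scalerDr mulmxDr !scalerA -!scalemxAr gu.
  by vring.
- have := mem _ _ Kpv Kqv; congr minkowski_sum.
  rewrite !scalerDr mulmxDr !scalerA -!scalemxAr gv.
  by vring.
Qed.

Lemma combination_convex (R : realType) (K1 K2 : set 'cV[R]_2) (g : 'M[int]_2) (l : R) :
  convex_set K1 -> convex_set K2 ->
  convex_set (minkowski_sum (dilate (1 - l) K1) (int_image g (dilate l K2))).
Proof.
move=> c1 c2; apply: convex_setP => _ _ a b [_ [x Kx <-] [_ [_ [y Ky <-] <-] <-]]
  [_ [x' Kx' <-] [_ [_ [y' Ky' <-] <-] <-]] a0 b0 ab.
exists ((1 - l) *: (a *: x + b *: x')).
  by exists (a *: x + b *: x') => //; exact: convex_set_combine.
exists (map_mx intr g *m (l *: (a *: y + b *: y'))).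
  exists (l *: (a *: y + b *: y')) => //.
  by exists (a *: y + b *: y') => //; exact: convex_set_combine.
rewrite -!scalemxAr mulmxDr -!scalemxAr.
by vring.
Qed.

Unset Implicit Arguments.

Theorem corollary1p5 (R : realType) (K1 K2 : set 'cV[R]_2)
  (hK1 : convex_body K1) (hK2 : convex_body K2) :
  exists2 g : 'M[int]_2, g \in unitmx &
    forall l : R, 0 <= l <= 1 ->
      ((1 - l)%:E * (covering_radius K1)^-1 + l%:E * (covering_radius K2)^-1
       <= (covering_radius
             (minkowski_sum (dilate (1 - l) K1)
                            (int_image g (dilate l K2))))^-1)%E.
Proof.
have [g1 [s1 [g1U s10 t1 t1' le1]]] := covering_triangles hK1.
have [g2 [s2 [g2U s20 t2 t2' le2]]] := covering_triangles hK2.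
(* This matrix maps the optimal basis of [K2] to that of [K1] and does not depend on [l]. *)
exists (g1 *m invmx g2); first by rewrite unitmx_mul g1U unitmx_inv.
move=> l /andP[l0 l1].
set M := minkowski_sum _ _.
have gE j : map_mx intr (g1 *m invmx g2) *m real_col R g2 j = real_col R g1 j.
  by rewrite /real_col -map_mxM !colE -!mulmxA mulKmx.
have gNE j : map_mx intr (g1 *m invmx g2) *m (- real_col R g2 j) = - real_col R g1 j.
  by rewrite mulmxN gE.
have tM := contains_triangle_combine l t1 t2 (gE 0) (gE 1).
have tM' := contains_triangle_combine l t1' t2' (gNE 0) (gNE 1).
set s := (1 - l) * s1 + l * s2 in tM tM'.
apply: (@le_trans _ _ s%:E).
  have -> : (s%:E = (1 - l)%:E * s1%:E + l%:E * s2%:E)%E by [].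
  apply: leeD.
  - by apply: lee_wpmul2l => //; rewrite lee_fin subr_ge0.
  - by apply: lee_wpmul2l.
have s_ge0 : 0 <= s by rewrite addr_ge0 // mulr_ge0 // subr_ge0.
(* For [s = 0] the bound is the nonnegativity of the inverse radius; otherwise [s^-1] is an
   admissible dilation factor for [M]. *)
have [s0|s0] := eqVneq s 0; first by rewrite s0 inve_ge0 covering_radius_ge0.
have sp : 0 < s by rewrite lt_def s0.
have cM : convex_set M by apply: combination_convex; [case: hK1|case: hK2].
have bas : lattice_basis (real_col R g1 0) (real_col R g1 1) by exists g1.
have cov := contains_triangles_covers cM bas sp tM tM'.
have -> : s%:E = ((s^-1)%:E^-1)%E by rewrite inver invr_eq0 gt_eqF // invrK.
rewrite lee_pV2.
- by apply: ereal_inf_lbound; exists s^-1 => //; split => //; rewrite invr_ge0 ltW.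
- by rewrite inE lee_fin invr_ge0 ltW.
- by rewrite inE covering_radius_ge0.
Qed.
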